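(* Let $x\in\mathbb{Z}^2$ be any individual, and suppose that $x$ adopts the strategy $\pi_x$ described in the context, irrespectively of the strategies adopted by all other individuals. Then there exists a random time $T_x$, finite with probability one, such that, with probability one, no reward of $x$ at a decision time after $T_x$ is negative: $$\mathbb{P}\big(h_{t}(x)\ge 0 \ \text{ for all decision times } t=t_{x,n}\ge T_x\big)=1 .$$
   Context: **Model.** $\mathbb{Z}^2$ carries the distance $d(x,y)=|x_1-y_1|+|x_2-y_2|$; $O=(0,0)$; $\Lambda_M=\{z\in\mathbb{Z}^2: d(O,z)\le M\}$ and $\Lambda_M(x)=\Lambda_M+x$. The configuration space is $S=\{-1,+1\}^{\mathbb{Z}^2}$ (product topology); $\eta_\Lambda$ is the restriction of $\eta\in S$ to $\Lambda$. $\mathcal{G}=(V,E)$ is a random graph with $V=\mathbb{Z}^2$ such that, with probability one, every pair $x,y$ with $d(x,y)=1$ is joined by an edge, and $\mathbb{P}(|\{y:\{x,y\}\in E\}|<\infty)=1$ for all $x\in V$. A function $j:V\times V\to\{-1,0,+1\}$ is given with $j(x,y)=0$ if $\{x,y\}\notin E$ and $j(x,y)\in\{-1,+1\}$ otherwise; $j$ need not be symmetric. A process $\sigma:[0,\infty)\to S$ evolves as follows. $\sigma_0$ has the symmetric Bernoulli product law. Each site $x$ has an independent rate-1 Poisson process with arrival times (decision times of individual $x$) $t_{x,1}<t_{x,2}<\dots$. The value $\sigma_t(x)$ changes only at these times, by $\sigma_{t_{x,n}}(x)=u_{x,n}$, where $u_{x,n}\in\{-1,+1\}$ is the decision of $x$;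 a strategy of $x$ is a sequence $(u_{x,1},u_{x,2},\dots)$. At each decision time $t=t_{x,n}$, individual $x$ receives (and observes) the reward $$h_t(x)=\operatorname{sgn}\Big(\sum_{y:\{x,y\}\in E} j(x,y)\sigma_t(x)\sigma_t(y)\Big)\in\{-1,0,+1\},\qquad \operatorname{sgn}(0)=0 .$$ Individuals know neither $E$ nor $j$. **The strategy $\pi_x$.** Write $t_n,u_n,h_n$ for $t_{x,n},u_{x,n},h_{t_{x,n}}(x)$. Individual $x$ maintains a collection $\mathcal{R}$ (initially empty) of triples $(\eta,u,h)$, where $\eta$ is a configuration on a finite ball $\Lambda_M(x)$, $u\in\{-1,+1\}$, $h\in\{-1,0,+1\}$. Recorded configurations are those seen immediately before the update, i.e. at time $t_n-$. - At time $t_1$: $u_1=\pm1$ is chosen by a fair coin toss, and $(\sigma_{\Lambda_1(x)},u_1,h_1)$ is added to $\mathcal{R}$. - At time $t_{n+1}$: let $\Lambda_{M_n}(x)$ be the support of the last configuration added to $\mathcal{R}$, and let $\sigma'=\sigma_{\Lambda_{M_n}(x)}(t_{n+1}-)$. (a) If there exists $(\sigma',u',h')\in\mathcal{R}$, set $u_{n+1}=u'\,\frac{h'}{|h'|}$, with the convention $0/|0|:=1$. If the resulting reward satisfies $h_{n+1}\ge 0$, nothing else is done; if $h_{n+1}<0$, add $(\sigma_{\Lambda_{M_n+1}(x)},u_{n+1},h_{n+1})$ to $\mathcal{R}$. (b) Otherwise set $u_{n+1}=u_n$ and add $(\sigma',u_{n+1},h_{n+1})$ to $\mathcal{R}$.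 *)

(* Defs.v *)
From HB Require Import structures.
From mathcomp Require Import all_boot all_order all_algebra.
From mathcomp Require Import all_classical all_reals all_analysis.
From mathcomp Require Import measurable_realfun.

Set Implicit Arguments.
Unset Strict Implicit.
Unset Printing Implicit Defensive.

Import Order.TTheory GRing.Theory Num.Theory.
Import numFieldNormedType.Exports.

Local Open Scope classical_set_scope.
Local Open Scope ring_scope.

Definition site : Type := (int * int)%type.

Definition dist (x y : site) : nat := (`|x.1 - y.1| + `|x.2 - y.2|)%N.

(* Spins are booleans, true standing for +1 and false for -1; [bool] carries the
   discrete topology and the discrete sigma-algebra. *)
Definition spinz (s : bool) : int := if s then 1 else -1.

Definition config : Type := site -> bool.

Section probability.
Context (d : measure_display) (Omega : measurableType d) (R : realType).
Context (P : probability Omega R).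

Definition mutually_independent (I : eqType) (F : I -> set (set Omega)) : Prop :=
  forall (s : seq I) (A : I -> set Omega), uniq s ->
    (forall i, i \in s -> F i (A i)) ->
    P (\bigcap_(i in [set` s]) A i) = (\prod_(i <- s) P (A i))%E.

Definition sigma_alg_of d' (T : measurableType d') (X : Omega -> T) :
    set (set Omega) :=
  preimage_set_system setT X measurable.

Definition sigma_alg_of_seq d' (T : measurableType d') (X : nat -> Omega -> T) :
    set (set Omega) :=
  <<s \bigcup_n sigma_alg_of (X n) >>.

(* [t n], n >= 1, is the n-th arrival time; [t 0 = 0] is a convention. *)
Definition rate1_poisson_process (t : nat -> {RV P >-> R}) : Prop :=
  let gap n w := t n.+1 w - t n w in
  [/\ forall w, t 0%N w = 0,
      forall n w, t n w < t n.+1 w,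
      forall n (A : set R), measurable A -> P (gap n @^-1` A) = exponential_prob 1 A &
      mutually_independent (fun n => sigma_alg_of (gap n))].

Definition fair (X : {RV P >-> bool}) : Prop :=
  distribution P X [set true] = (2^-1)%:E /\
  distribution P X [set false] = (2^-1)%:E.

Definition random_graph (edge : Omega -> rel site) : Prop :=
  [/\ forall w, symmetric (edge w) /\ irreflexive (edge w),
      forall y z, measurable [set w | edge w y z],
      {ae P, forall w, forall y z, dist y z = 1%N -> edge w y z} &
      forall y, {ae P, forall w, finite_set [set z | edge w y z]}].

Definition random_couplings (edge : Omega -> rel site)
    (j : Omega -> site -> site -> int) : Prop :=
  (forall y z (k : int), measurable [set w | j w y z = k]) /\
  (forall w y z, if edge w y z then j w y z = 1 \/ j w y z = -1
                 else j w y z = 0).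

(* Sources of randomness: the clock of each site, the initial spin of each
   site, and the coin tossed by one distinguished individual. *)
Definition source_sigma_alg (t : site -> nat -> {RV P >-> R})
    (sigma0 : site -> {RV P >-> bool}) (coin : {RV P >-> bool})
    (i : site + site + unit) : set (set Omega) :=
  match i with
  | inl (inl y) => sigma_alg_of_seq (t y)
  | inl (inr y) => sigma_alg_of (sigma0 y)
  | inr tt => sigma_alg_of coin
  end.

End probability.

Section dynamics.
Context (R : realType).

(* One realization of the process.  [t y n] and [u y n], n >= 1, are the n-th
   decision time and the n-th decision of y; [u y 0] is not used. *)
Definition last_decision (eta0 : config) (u : site -> nat -> bool)
    (y : site) (n : nat) : bool :=
  if n is 0%N then eta0 y else u y n.

(* The index picked by [xget] is the number of decisions of y up to time s; it
   exists and is unique for every s >= 0 when [t y] increases strictly from 0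
   to infinity. *)
Definition state (t : site -> nat -> R) (eta0 : config)
    (u : site -> nat -> bool) (s : R) : config :=
  fun y => last_decision eta0 u y (xget 0%N [set n | t y n <= s < t y n.+1]).

(* The left limit in the product topology, taken coordinatewise. *)
Definition state_before (t : site -> nat -> R) (eta0 : config)
    (u : site -> nat -> bool) (s : R) : config :=
  fun y => lim ((fun r => state t eta0 u r y) @ s^'-).

(* \sum_(y \in _) is 0 by convention when infinitely many terms are nonzero. *)
Definition reward (e : rel site) (J : site -> site -> int) (eta : config)
    (x : site) : int :=
  Num.sg (\sum_(y \in [set y | e x y]) J x y * spinz (eta x) * spinz (eta y)).

(* A configuration on a finite set of sites: a partial function with that
   domain. *)
Definition local_config : Type := site -> option bool.

Definition restrict_ball (x : site) (M : nat) (eta : config) : local_config :=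
  fun z => if (dist x z <= M)%N then Some (eta z) else None.

(* [radius] is the M such that the ball of radius M around x is the support of
   the configuration most recently added to [records]. *)
Record memory : Type := Memory {
  records : set (local_config * bool * int);
  radius : nat
}.

Definition known (m : memory) (c : local_config) : Prop :=
  exists u' h', records m (c, u', h').

(* h / |h|, with the convention 0 / |0| = 1. *)
Definition unit_sign (h : int) : int :=
  if h == 0 then 1 else (h %/ `|h|)%Z.

Definition decides (m : memory) (c : local_config) (prev new : bool) : Prop :=
  (known m c -> exists u' h',
     records m (c, u', h') /\ spinz new = spinz u' * unit_sign h') /\
  (~ known m c -> new = prev).

Definition update (x : site) (m : memory) (eta : config) (u : bool) (h : int) :
    memory :=
  let c := restrict_ball x (radius m) eta in
  if `[< known m c >] then
    if 0 <= h then m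
    else Memory (records m `|`
                   [set (restrict_ball x (radius m).+1 eta, u, h)])
                (radius m).+1
  else Memory (records m `|` [set (c, u, h)]) (radius m).

(* Memory after the n-th decision, [eta n], [u n], [h n] being the
   configuration just before the n-th decision, the decision and the reward
   (n >= 1).  Starting from an empty collection with radius 1, the first update
   records (eta 1 on the ball of radius 1, u 1, h 1). *)
Fixpoint memory_after (x : site) (eta : nat -> config) (u : nat -> bool)
    (h : nat -> int) (n : nat) : memory :=
  if n is k.+1 then update x (memory_after x eta u h k) (eta n) (u n) (h n)
  else Memory set0 1.

(* The rule of the strategy pi_x for all decisions but the first, which is the
   coin toss. *)
Definition follows_pi (x : site) (eta : nat -> config) (u : nat -> bool)
    (h : nat -> int) : Prop :=
  forall n, (0 < n)%N ->
    let m := memory_after x eta u h n in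
    decides m (restrict_ball x (radius m) (eta n.+1)) (u n) (u n.+1).

End dynamics.

Section process.
Context (d : measure_display) (Omega : measurableType d) (R : realType).
Context (P : probability Omega R).
Context (edge : Omega -> rel site) (j : Omega -> site -> site -> int).
Context (sigma0 : site -> {RV P >-> bool}) (t : site -> nat -> {RV P >-> R}).
Context (u : site -> nat -> {RV P >-> bool}).

Definition sigma (s : R) (w : Omega) : config :=
  state (fun y n => t y n w) (fun y => sigma0 y w) (fun y n => u y n w) s.

Definition sigma_before (s : R) (w : Omega) : config :=
  state_before (fun y n => t y n w) (fun y => sigma0 y w)
    (fun y n => u y n w) s.

Definition reward_at (x : site) (s : R) (w : Omega) : int :=
  reward (edge w) (j w) (sigma s w) x.

Definition adopts_pi (x : site) : Prop :=
  fair (u x 1%N) /\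
  forall w, follows_pi x (fun n => sigma_before (t x n w) w)
              (fun n => u x n w) (fun n => reward_at x (t x n w) w).

End process.

(* Main.v *)
(* Fix a realization in which x has finitely many neighbours and no other
   individual decides, or accumulates infinitely many decisions, at a decision
   time of x.  Then the n-th reward of x is u_n times a function f of the
   configuration just before t_n on a ball of some radius M.  The radius in the
   memory of x grows by one whenever a recalled record fails, and cannot do so
   beyond max(M, 1): on a ball of radius at least M, a record determines f.
   Hence the radius stabilizes, after which negative rewards occur only at
   configurations on a fixed finite ball that are not recorded yet, i.e.
   finitely many times.

   Each of the excluded coincidences has the form t_{x,n} = Z with Z a function
   of the clock of another individual, thus independent of t_{x,n}, whose law
   has no atoms since its last gap is exponential and independent of the past. *)
Require Import Defs.
From HB Require Import structures.
From mathcomp Require Import all_boot all_order all_algebra.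
From mathcomp Require Import all_classical all_reals all_analysis.
From mathcomp Require Import measurable_realfun.
From mathcomp Require Import zify.

Set Implicit Arguments.
Unset Strict Implicit.
Unset Printing Implicit Defensive.

Import Order.TTheory GRing.Theory Num.Theory.
Import numFieldNormedType.Exports.

Local Open Scope classical_set_scope.
Local Open Scope ring_scope.

(** * Finiteness of configurations on a ball *)

Lemma finite_set_nat_bounded (A : set nat) : finite_set A ->
  exists N, forall n, A n -> (n < N)%N.
Proof.
move=> /finite_seqP[s ->]; exists (\max_(i <- s) i).+1 => n /= ns.
by rewrite ltnS (@leq_bigmax_seq _ s xpredT id n).
Qed.

Lemma homo_bounded_stationary (f : nat -> nat) (B : nat) :
  (forall n, (f n <= f n.+1)%N) -> (forall n, (f n <= B)%N) ->
  exists N, forall n, (N <= n)%N -> f n = f N.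
Proof.
move=> f_homo f_le.
have exf : exists i, `[< exists n, f n = i >].
  by exists (f 0%N); apply/asboolP; exists 0%N.
have ubf i : `[< exists n, f n = i >] -> (i <= B)%N by move=> /asboolP[n <-].
case: (ex_maxnP exf ubf) => i /asboolP[N fN] fmax.
exists N => n Nn; apply/eqP; rewrite eqn_leq.
rewrite (homo_leq leqnn leq_trans f_homo Nn) andbT fN fmax //.
by apply/asboolP; exists n.
Qed.

(** An explicit finite list containing the ball: the square of side 2M+1 around [x], with offsets
    from -M to M. *)
Definition box (x : site) (M : nat) : seq site :=
  [seq (x.1 + (a%:Z - M%:Z), x.2 + (b%:Z - M%:Z))
     | a <- iota 0 M.*2.+1, b <- iota 0 M.*2.+1].

Lemma mem_box (x z : site) (M : nat) : (dist x z <= M)%N -> z \in box x M.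
Proof.
case: x z => [x1 x2] [z1 z2]; rewrite /dist /= => xz.
apply/allpairsP; exists (absz (z1 - x1 + M%:Z), absz (z2 - x2 + M%:Z)).
by split; rewrite ?mem_iota ?[_.1]/= ?[_.2]/=;
  [lia|lia|congr pair => /=; lia].
Qed.

Lemma restrict_ballE (x : site) (M : nat) (eta eta' : config) :
  {in box x M, eta =1 eta'} -> restrict_ball x M eta = restrict_ball x M eta'.
Proof.
by move=> ee; apply/funext => z; rewrite /restrict_ball; case: ifP => // /mem_box/ee ->.
Qed.

(** A restriction is determined by the tuple of spins along [box x M], and such tuples form a finite
    type. *)
Lemma finite_restrict_ball (x : site) (M : nat) :
  finite_set (range (restrict_ball x M)).
Proof.
pose B := box x M.
pose g (v : (size B).-tuple bool) : local_config :=
  restrict_ball x M (fun z => nth true v (index z B)).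
apply: (@sub_finite_set _ _ (range g)); last first.
  by apply: finite_image; exact: finite_finset.
move=> _ [eta _ <-]; exists (map_tuple eta (in_tuple B)) => //.
by apply: restrict_ballE => z zB; rewrite (nth_map z) ?index_mem// nth_index.
Qed.

Lemma unit_sign_mul_ge0 (h : int) : 0 <= unit_sign h * h.
Proof.
rewrite /unit_sign; case: eqVneq => [->|h0]; first by rewrite mulr0.
by rewrite {1}[h]numEsg mulzK ?normr_eq0// -normrEsg.
Qed.

(** * The memory of [pi_x] along one realization *)

Section pi_strategy.
Variables (x : site) (eta : nat -> config) (u : nat -> bool) (h : nat -> int).
Variables (f : config -> int) (M : nat).
Hypothesis f_local : forall e e',
  restrict_ball x M e = restrict_ball x M e' -> f e = f e'.
Hypothesis hE : forall n, (0 < n)%N -> h n = spinz (u n) * f (eta n).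
Hypothesis u_pi : follows_pi x eta u h.

Let mem_ n := memory_after x eta u h n.
(** The index is shifted: this configuration is looked up in the memory left by [n] decisions in
    order to take decision [n.+1]. *)
Let seen n := restrict_ball x (Defs.radius (mem_ n)) (eta n.+1).

Lemma memS n : mem_ n.+1 = update x (mem_ n) (eta n.+1) (u n.+1) (h n.+1).
Proof. by []. Qed.

Lemma recordsS_subset n : records (mem_ n) `<=` records (mem_ n.+1).
Proof.
rewrite memS /update; case: asboolP => _ /=; last by move=> ? ?; left.
by case: ifP => _ /= ? ?; [|left].
Qed.

Lemma known_leq n k c : (n <= k)%N -> known (mem_ n) c -> known (mem_ k) c.
Proof.
move=> + [v [g]]; elim: k => [|k IHk]; first by rewrite leqn0 => /eqP -> ?; exists v, g.
rewrite leq_eqVlt ltnS => /predU1P[-> nvg|/IHk/[apply] -[w [i wi]]]; first by exists v, g.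
by exists w, i; exact: recordsS_subset.
Qed.

Lemma leq_radiusS n : (Defs.radius (mem_ n) <= Defs.radius (mem_ n.+1))%N.
Proof. by rewrite memS /update; case: asboolP => // _; case: ifP. Qed.

(** A triple is stored only with a reward actually observed, and [hE] expresses that reward. The
    radius stays existential because a failed recall stores a larger ball than the one looked up. *)
Lemma record_reward n c v g : records (mem_ n) (c, v, g) ->
  exists r e, c = restrict_ball x r e /\ g = spinz v * f e.
Proof.
elim: n c v g => [//|n IHn] c v g; rewrite memS /update.
have step r : records (mem_ n) (c, v, g) \/
    (c, v, g) = (restrict_ball x r (eta n.+1), u n.+1, h n.+1) ->
    exists r e, c = restrict_ball x r e /\ g = spinz v * f e.
  case=> [/IHn//|[-> -> ->]]; exists r, (eta n.+1); split => //.
  by rewrite hE.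
by case: asboolP => _; [case: ifP => _ /=; [exact: IHn|exact: step]|exact: step].
Qed.

(* Once the ball contains all neighbours, the record found gives the reward of
   either decision, and pi_x picks a sign for which it is not negative. *)
Lemma known_reward_ge0 n : (0 < n)%N -> (M <= Defs.radius (mem_ n))%N ->
  known (mem_ n) (seen n) -> 0 <= h n.+1.
Proof.
move=> n0 Mr kn; have [/(_ kn)[v [g [/record_reward[r [e [seenE gE]]] uE]]] _] := u_pi n0.
rewrite hE // uE mulrAC (_ : f (eta n.+1) = f e) -?gE 1?mulrC ?unit_sign_mul_ge0//.
(* A site [z] of the ball of radius [M] lies in the current ball, so equality with the recorded
   partial function forces [z] into its domain too, whatever [r] is. *)
apply: f_local; apply/funext => z; rewrite /restrict_ball; case: ifP => // xz.
have := congr1 (fun c : local_config => c z) seenE.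
by rewrite /seen /restrict_ball (leq_trans xz Mr); case: ifP => // _ [->].
Qed.

(** Growth requires a negative reward at a known configuration, which [known_reward_ge0] excludes
    from radius [M] on; the 1 is the initial radius. *)
Lemma radius_leq n : (Defs.radius (mem_ n) <= maxn M 1)%N.
Proof.
elim: n => [|n IHn]; first by rewrite leq_maxr.
rewrite memS /update; case: asboolP => // kn; case: ifP => // /negbT hn /=.
(* At the first decision the collection is empty, so nothing is known and the radius cannot grow. *)
case: n kn hn IHn => [[? []//]|n kn hn _].
by rewrite leq_max ltnNge; apply/orP; left; apply: contra hn => /known_reward_ge0 ->.
Qed.

Lemma follows_pi_eventually_ge0 :
  exists N, forall n, (N <= n)%N -> 0 <= h n.
Proof.
have [N rN] := homo_bounded_stationary leq_radiusS radius_leq.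
pose B := [set n | (N <= n)%N /\ ~ known (mem_ n) (seen n)].
have seen_known n : ~ known (mem_ n) (seen n) -> known (mem_ n.+1) (seen n).
  move=> unk; exists (u n.+1), (h n.+1).
  by rewrite memS /update; case: asboolP => //= _; right.
(* An unknown configuration is recorded at once and never forgotten, so it cannot be unknown a
   second time. *)
have seen_inj : {in B &, injective seen}.
  move=> n k /set_mem[_ nB] /set_mem[_ kB] nk; apply: contrapT => /eqP.
  rewrite neq_ltn => /orP[lt_nk|lt_kn].
    by apply: kB; rewrite -nk; exact/(known_leq lt_nk)/seen_known.
  by apply: nB; rewrite nk; exact/(known_leq lt_kn)/seen_known.
have finB : finite_set B.
  rewrite -(eq_finite_set (inj_card_eq seen_inj)).
  apply: sub_finite_set (finite_restrict_ball x (Defs.radius (mem_ N))).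
  by move=> _ [n [Nn _] <-]; exists (eta n.+1); rewrite // /seen rN.
have [K BK] := finite_set_nat_bounded finB.
exists (maxn N K).+1 => -[//|n]; rewrite ltnS geq_max => /andP[Nn Kn].
rewrite leNgt; apply/negP => hn.
have kn : known (mem_ n) (seen n).
  by apply: contrapT => unk; have := BK n (conj Nn unk); rewrite ltnNge Kn.
(* A negative reward at a known configuration would increase the radius, which is constant from [N]
   on. *)
have := rN n.+1 (leqW Nn); rewrite -(rN n Nn) memS /update.
case: asboolP => // _; rewrite leNgt hn /= => /eqP.
by rewrite eqn_leq ltnn.
Qed.

End pi_strategy.

(** * Spins and rewards along one realization *)

Section paths.
Context (R : realType).
Implicit Types (t : site -> nat -> R) (u : site -> nat -> bool).

Lemma epoch_set1 (a : nat -> R) (s : R) (k : nat) :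
  (forall n, a n < a n.+1) -> a k <= s < a k.+1 ->
  [set n | a n <= s < a n.+1] = [set k].
Proof.
move=> a_incr /andP[aks sak]; apply/seteqP; split => n /=; last first.
  by move=> ->; rewrite aks.
have a_le i j : (i <= j)%N -> a i <= a j.
  by apply: (homo_leq lexx le_trans) => {}i; exact: ltW.
move=> /andP[ans san]; apply/eqP; rewrite eqn_leq; apply/andP; split.
  by rewrite leqNgt; apply/negP => /a_le/(lt_le_trans sak); rewrite ltNge ans.
by rewrite leqNgt; apply/negP => /a_le/(lt_le_trans san); rewrite ltNge aks.
Qed.

Lemma state_epoch t (eta0 : config) u (y : site) (s : R) (k : nat) :
  (forall n, t y n < t y n.+1) -> t y k <= s < t y k.+1 ->
  state t eta0 u s y = last_decision eta0 u y k.
Proof.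
by move=> t_incr tk; rewrite /state (epoch_set1 t_incr tk) (@xget_unique _ _ _ k).
Qed.

(* If y explodes before s, then its state is frozen at its initial value from
   the explosion time on, so only an explosion at s itself must be excluded.
   Without explosion the supremum is the junk value 0. *)
Lemma state_before_epoch t (eta0 : config) u (y : site) (s : R) :
  t y 0%N = 0 -> (forall n, t y n < t y n.+1) -> 0 <= s ->
  (forall k, t y k != s) -> sup (range (t y)) != s ->
  state_before t eta0 u s y = state t eta0 u s y.
Proof.
move=> t0 t_incr s0 tNs supNs; rewrite /state_before.
apply: lim_near_cst; first exact: discrete_hausdorff.
have [[k /[dup] tks /andP[tk tkS]]|noepoch] :=
    pselect (exists k, t y k <= s < t y k.+1).
  have {}tk : t y k < s by rewrite lt_neqAle tNs.
  near=> r; rewrite !(@state_epoch _ _ _ _ _ k)//; apply/andP; split.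
    by near: r; exact: nbhs_left_ge.
  by rewrite (lt_trans _ tkS).
have t_le k : t y k <= s.
  elim: k => [|k IHk]; first by rewrite t0.
  by rewrite leNgt; apply/negP => tkS; apply: noepoch; exists k; rewrite IHk.
have sup_t : has_sup (range (t y)).
  by split; [exists (t y 0%N), 0%N|exists s => _ [k _ <-]].
have lt_sup_s : sup (range (t y)) < s.
  by rewrite lt_neqAle supNs ge_sup//; [case: sup_t|move=> _ [k _ <-]].
(* After the explosion neither [r] nor [s] lies in an epoch: both index sets are empty, and [xget]
   returns the same default. *)
near=> r; rewrite /state; congr (last_decision eta0 u y (xget _ _)).
have lt_sup_r : sup (range (t y)) < r by near: r; exact: nbhs_left_gt.
have t_lt k : t y k < r.
  by apply: le_lt_trans lt_sup_r; apply: ub_le_sup; [case: sup_t|exists k].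
apply/seteqP; split => k /= /andP[_]; first by rewrite ltNge (ltW (t_lt _)).
by rewrite ltNge t_le.
Unshelve. all: by end_near. Qed.

Lemma sgr_spinz (s : bool) : Num.sg (spinz s) = spinz s.
Proof. by case: s. Qed.

Lemma finite_set_box (x : site) (A : set site) : finite_set A ->
  exists M, forall y, A y -> (dist x y <= M)%N.
Proof.
move=> /finite_seqP[s ->]; exists (\max_(y <- s) dist x y)%N => y /= ys.
exact: (@leq_bigmax_seq _ s xpredT (dist x) y).
Qed.

Lemma rewards_eventually_ge0 t (eta0 : config) u (e : rel site) (J : site -> site -> int)
    (x : site) :
  (forall y, t y 0%N = 0) -> (forall y n, t y n < t y n.+1) ->
  irreflexive e -> finite_set [set y | e x y] ->
  (forall y n k, y != x -> (0 < n)%N -> t y k != t x n) ->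
  (forall y n, y != x -> (0 < n)%N -> sup (range (t y)) != t x n) ->
  follows_pi x (fun n => state_before t eta0 u (t x n)) (u x)
    (fun n => reward e J (state t eta0 u (t x n)) x) ->
  exists N, forall n, (N <= n)%N -> 0 <= reward e J (state t eta0 u (t x n)) x.
Proof.
move=> t0 t_incr e_irr e_fin tN supN.
have [M eM] := finite_set_box x e_fin.
pose f (eta : config) := Num.sg (\sum_(y \in [set y | e x y]) J x y * spinz (eta y)).
apply: (@follows_pi_eventually_ge0 x _ (u x) _ f M) => [eta eta' ee|n n0].
  congr Num.sg; apply: eq_fsbigr => y; rewrite inE /= => exy.
  have := congr1 (fun c : local_config => c y) ee.
  by rewrite /restrict_ball eM// => -[->].
(* The factor [u n] moves inside the sign. At time [t x n] the spin of [x] is already [u n], while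
   its neighbours, all distinct from [x], still have their left limits. *)
rewrite -[X in X * _]sgr_spinz -sgrM mulr_fsumr//; congr Num.sg.
apply: eq_fsbigr => y; rewrite inE /= => exy.
have yx : y != x by apply: contraTneq exy => ->; rewrite e_irr.
rewrite (@state_epoch _ _ _ x _ n)// ?lexx//= state_before_epoch//; last 3 first.
- by elim: n {n0} => [|n IHn]; [rewrite t0|exact/ltW/(le_lt_trans IHn)].
- by move=> k; exact: tN.
- exact: supN.
by case: n n0 => // n _; rewrite mulrCA mulrA.
Qed.

End paths.

(** * Independence and atomless laws *)

Section independence.
Context (d : measure_display) (Omega : measurableType d) (R : realType).
Context (P : probability Omega R).

(** Dynkin's pi-lambda argument: the events independent of [E] form a lambda-system containing the
    pi-system [G]. *)
Lemma indep_g_sigma_algebra (E : set Omega) (G : set (set Omega)) :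
  measurable E -> setI_closed G -> G `<=` measurable ->
  (forall F, G F -> P (E `&` F) = (P E * P F)%E) ->
  forall F, <<s G >> F -> P (E `&` F) = (P E * P F)%E.
Proof.
move=> mE GI Gm EG.
have PE_fin := fin_num_measure P E mE.
pose H := [set F | measurable F /\ P (E `&` F) = (P E * P F)%E].
suff GH : <<s G >> `<=` H by move=> F /GH[].
apply: lambda_system_subset => //; last by move=> F GF; split; [exact: Gm|exact: EG].
apply/dynkin_lambda_system; split => [|F [mF EF]|F tF HF].
- by split; [exact: measurableT|rewrite setIT probability_setT mule1].
- split; first exact: measurableC.
  rewrite -setDE measureD//; last by rewrite ltey_eq PE_fin.
  rewrite [X in (_ - X)%E]EF probability_setC//.
  by rewrite muleBr ?mule1// fin_num_adde_defr.
- have mF i : measurable (F i) by case: (HF i).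
  split; first exact: bigcup_measurable.
  rewrite setI_bigcupr !measure_bigcup//; last first.
  + exact: trivIset_setIl.
  + by move=> i _; exact: measurableI.
  rewrite -(fineK PE_fin) -nneseriesZl//.
  by apply: eq_eseriesr => i _; rewrite fineK//; case: (HF i).
Qed.

(** By independence the law of (Z, X) is a product measure. The section of the diagonal at [z] is
    the singleton of [z], null for the law of [X], so Fubini gives the diagonal mass 0. *)
Lemma atomless_indep_neq (X Z : {mfun Omega >-> R}) :
  (forall A B, measurable A -> measurable B ->
    P (X @^-1` A `&` Z @^-1` B) = (P (X @^-1` A) * P (Z @^-1` B))%E) ->
  (forall c, P (X @^-1` [set c]) = 0%E) ->
  P [set w | X w = Z w] = 0%E.
Proof.
move=> XZ_indep X_atomless.
have mXZ : measurable_fun [set: Omega] (fun w => (Z w, X w)).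
  exact: measurable_fun_pair.
pose ZX : {mfun Omega >-> (R * R)%type} := HB.pack (fun w => (Z w, X w))
  (isMeasurableFun.Build _ _ _ _ _ mXZ).
pose D := [set p : (R * R)%type | p.1 = p.2].
have mD : measurable D.
  have := measurable_fun_eqr (@measurable_fst _ _ R R) (@measurable_snd _ _ R R).
  move=> /(_ measurableT [set true] I); rewrite setTI; congr measurable.
  by apply/seteqP; split => p /= /eqP.
have ZX_law A B : measurable A -> measurable B ->
    distribution P ZX (A `*` B) = (distribution P Z A * distribution P X B)%E.
  move=> mA mB; rewrite /distribution /pushforward muleC -XZ_indep//.
  by congr (P _); rewrite setIC.
have := product_measure_unique ZX_law mD.
move=> eqD.
rewrite [LHS](_ : _ = distribution P ZX D); last first.
  by congr (P _); apply/seteqP; split => w /esym.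
rewrite -eqD; apply: integral0_eq => z _.
rewrite -[RHS](X_atomless z); congr (P _).
by apply/seteqP; split => w; rewrite /xsection /= in_setE.
Qed.

End independence.

(** * Arrival times have no atoms and avoid independent times *)

Section arrival_times.
Context (d : measure_display) (Omega : measurableType d) (R : realType).
Context (P : probability Omega R).

(** The event [t n.+1 = c] reads [gap n = c - t n], where the right side is a function of the first
    [n] gaps, hence independent of the atomless [gap n]. *)
Lemma poisson_arrival_atomless (t : nat -> {RV P >-> R}) (n : nat) (c : R) :
  rate1_poisson_process t -> (0 < n)%N -> P (t n @^-1` [set c]) = 0%E.
Proof.
case: n => // n [t0 t_incr gap_law gap_indep] _.
set gap := fun n w => t n.+1 w - t n w in gap_law gap_indep.
have mgap k : measurable_fun [set: Omega] (gap k) by exact: measurable_funB.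
(* The pi-system generating the sigma-algebra of the first n gaps. *)
pose G := [set F | exists A : nat -> set Omega,
  (forall i, sigma_alg_of (gap i) (A i)) /\ F = \bigcap_(i in [set` iota 0 n]) A i].
have sigma_gapI i A B : sigma_alg_of (gap i) A -> sigma_alg_of (gap i) B ->
    sigma_alg_of (gap i) (A `&` B).
  move=> [A' mA' <-] [B' mB' <-]; exists (A' `&` B'); first exact: measurableI.
  by rewrite !setTI.
have sigma_gap_measurable i A : sigma_alg_of (gap i) A -> measurable A.
  by move=> [B mB <-]; exact: mgap.
have GI : setI_closed G.
  move=> _ _ [A [sA ->]] [B [sB ->]]; exists (fun i => A i `&` B i); split.
    by move=> i; exact: sigma_gapI.
  by rewrite bigcapI.
have Gm : G `<=` measurable.
  move=> _ [A [sA ->]]; apply: fin_bigcap_measurable => // i _.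
  exact: sigma_gap_measurable (sA i).
have G_indep E : sigma_alg_of (gap n) E ->
    forall F, <<s G >> F -> P (E `&` F) = (P E * P F)%E.
  move=> sE; apply: indep_g_sigma_algebra => //.
    exact: sigma_gap_measurable sE.
  move=> _ [A [sA ->]].
  (* Putting [E] at index [n] lets the independence of the gaps be applied to [n :: iota 0 n], then
     again to [iota 0 n] to regroup the product. *)
  pose A' i := if i == n then E else A i.
  have sA' i : sigma_alg_of (gap i) (A' i) by rewrite /A'; case: eqP => // ->.
  have A'A : {in iota 0 n, A' =1 A}.
    by move=> i; rewrite mem_iota /A' => /andP[_]; case: ltngtP.
  have iotaN : n \notin iota 0 n by rewrite mem_iota ltnn.
  have := gap_indep (n :: iota 0 n) A'; rewrite /= iotaN iota_uniq big_cons.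
  move=> /(_ isT (fun i _ => sA' i)).
  rewrite (eq_big_seq (fun i => P (A i))); last by move=> i /A'A ->.
  rewrite -gap_indep ?iota_uniq//; last by move=> i _; exact: sA.
  rewrite bigcap_seq big_cons -bigcap_seq (_ : A' n = E); last by rewrite /A' eqxx.
  by rewrite (eq_bigcapr A'A).
have past_gap k : (k < n)%N ->
    measurable_fun [set: g_sigma_algebraType G] (gap k : g_sigma_algebraType G -> R).
  move=> kn _ B mB; apply: sub_sigma_algebra.
  (* An event about a single gap joins the pi-system when padded with the full set at the other
     indices. *)
  exists (fun i => if i == k then [set: Omega] `&` gap k @^-1` B else setT); split.
    move=> i; case: eqVneq => [->|_]; first by exists B.
    by exists setT => //; rewrite preimage_setT setTI.
  apply/seteqP; split => w /=; first by move=> ? i _; case: ifP.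
  by move=> /(_ k); rewrite /= mem_iota eqxx; exact.
have past k : (k <= n)%N ->
    measurable_fun [set: g_sigma_algebraType G] (t k : g_sigma_algebraType G -> R).
  elim: k => [_|k IHk kn].
    rewrite (_ : (t 0%N : _ -> R) = cst 0).
      exact: (@measurable_cst _ _ (g_sigma_algebraType G) R setT 0).
    by apply/funext => w; exact: t0.
  rewrite (_ : (t k.+1 : _ -> R) = gap k \+ t k).
    by apply: measurable_funD; [exact: past_gap|exact: IHk (ltnW kn)].
  by apply/funext => w; rewrite /gap /= subrK.
have mZ : measurable_fun [set: Omega] (fun w => c - t n w) by exact: measurable_funB.
pose X : {mfun Omega >-> R} :=
  HB.pack (gap n) (isMeasurableFun.Build _ _ _ _ _ (mgap n)).
pose Z : {mfun Omega >-> R} :=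
  HB.pack (fun w => c - t n w) (isMeasurableFun.Build _ _ _ _ _ mZ).
rewrite -[RHS](@atomless_indep_neq _ _ _ P X Z).
- congr (P _); apply/seteqP; split => w /=; rewrite /gap.
    by move=> <-.
  by move=> /(canRL (subrK _)); rewrite subrK.
- move=> A B mA mB; apply: G_indep; first by exists A => //; rewrite setTI.
  rewrite -[Z @^-1` B]setTI.
  have : measurable_fun [set: g_sigma_algebraType G]
    ((fun w => c - t n w) : g_sigma_algebraType G -> R).
    by apply: measurable_funB; [exact: measurable_cst|exact: past].
  by move=> /(_ measurableT B mB).
- by move=> e; rewrite gap_law// /exponential_prob integral_set1.
Qed.

(** [Z] may be any function of another source: it will be an arrival time or the explosion time of
    another clock. Independence of the two sources reduces the claim to [atomless_indep_neq]. *)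
Lemma arrival_neq (J : choiceType) (F : J -> set (set Omega)) (i k : J)
    (t : nat -> {RV P >-> R}) (Z : Omega -> R) (n : nat) :
  mutually_independent P F -> i != k ->
  sigma_alg_of_seq t `<=` F i -> rate1_poisson_process t -> (0 < n)%N ->
  F k `<=` measurable -> preimage_set_system setT Z measurable `<=` F k ->
  {ae P, forall w, Z w != t n w}.
Proof.
move=> F_indep ik tF t_poisson n0 Fm ZF.
have mZ : measurable_fun [set: Omega] Z.
  by move=> _ B mB; apply/Fm/ZF; exists B.
pose Z' : {mfun Omega >-> R} := HB.pack Z (isMeasurableFun.Build _ _ _ _ _ mZ).
have tZ_null : P [set w | t n w = Z' w] = 0%E.
  apply: atomless_indep_neq => [A B mA mB|c]; last exact: poisson_arrival_atomless.
  pose C l := if l == i then t n @^-1` A else Z @^-1` B.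
  have uniq_ik : uniq [:: i; k] by rewrite /= mem_seq1 ik.
  have := F_indep _ C uniq_ik.
  rewrite !big_cons big_nil mule1 bigcap_seq !big_cons big_nil setIT.
  rewrite /C eqxx [k == i]eq_sym (negbTE ik); apply => l; rewrite !inE.
  case: eqVneq => [-> _|_ /eqP ->].
    by apply: tF; apply: sub_sigma_algebra; exists n => //; exists A => //; rewrite setTI.
  by apply: ZF; exists B => //; rewrite setTI.
exists [set w | t n w = Z' w]; split => //.
  by have := measurable_fun_eqr (@measurable_funPT _ _ _ _ (t n)) mZ
    => /(_ measurableT [set true] I); rewrite setTI; congr measurable;
    apply/seteqP; split => w /= /eqP.
by move=> w /= /negP; rewrite negbK => /eqP.
Qed.

End arrival_times.

(** * Measurability of the event of a negative reward *)

Section measurability.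
Context (d : measure_display) (Omega : measurableType d) (R : realType).

(** For countable [T] this is measurability for the discrete sigma-algebra; it treats [bool], [nat]
    and [int] uniformly. *)
Definition measurable_fibers (T : Type) (X : Omega -> T) :=
  forall v, measurable [set w | X w = v].

Lemma measurable_fibers_cst (T : eqType) (v : T) :
  measurable_fibers (fun=> v : T).
Proof.
move=> v'; case: (eqVneq v v') => [->|/eqP vv'].
  by rewrite [X in measurable X](_ : _ = setT)//; apply/seteqP; split.
by rewrite [X in measurable X](_ : _ = set0)//; apply/seteqP; split.
Qed.

Lemma measurable_fibers2 (T1 T2 : countType) (T : eqType) (f : T1 -> T2 -> T)
    (X : Omega -> T1) (Y : Omega -> T2) :
  measurable_fibers X -> measurable_fibers Y ->
  measurable_fibers (fun w => f (X w) (Y w)).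
Proof.
move=> mX mY v.
pose F (p : T1 * T2) := if f p.1 p.2 == v
  then [set w | X w = p.1] `&` [set w | Y w = p.2] else set0.
rewrite (_ : [set w | _] = \bigcup_p F p).
  apply: countable_bigcupT_measurable => [|p]; first exact: countableP.
  by rewrite /F; case: eqP => _ //; exact: measurableI.
apply/seteqP; split => w /=.
  by move=> fv; exists (X w, Y w) => //; rewrite /F fv eqxx.
by move=> [p _]; rewrite /F; case: eqP => // <- [/= -> ->].
Qed.

Lemma measurable_fibers_funT (X : {mfun Omega >-> bool}) : measurable_fibers X.
Proof.
by move=> b; have := measurable_funPT X measurableT [set b]; rewrite setTI; exact.
Qed.

Lemma measurable_epoch (a : nat -> {mfun Omega >-> R}) (s : {mfun Omega >-> R}) (k : nat) :
  measurable [set w | a k w <= s w < a k.+1 w].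
Proof.
have mX (X : {mfun Omega >-> R}) : measurable_fun [set: Omega] X.
  exact: measurable_funPT.
have := measurable_and (measurable_fun_ler (mX (a k)) (mX s))
  (measurable_fun_ltr (mX s) (mX (a k.+1))).
by move=> /(_ measurableT [set true]); rewrite setTI; exact.
Qed.

Lemma measurable_fibers_epoch (a : nat -> {mfun Omega >-> R}) (s : {mfun Omega >-> R}) :
  (forall w n, a n w < a n.+1 w) ->
  measurable_fibers (fun w => xget 0%N [set n | a n w <= s w < a n.+1 w]).
Proof.
move=> a_incr k.
pose E k := [set w | a k w <= s w < a k.+1 w].
have mE n : measurable (E n) by exact: measurable_epoch.
have xgetE n w : E n w -> xget 0%N [set n | a n w <= s w < a n.+1 w] = n.
  by move=> Enw; rewrite (epoch_set1 (a_incr w) Enw) (@xget_unique _ _ _ n).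
have xget0 w : ~ (exists n, E n w) -> xget 0%N [set n | a n w <= s w < a n.+1 w] = 0%N.
  by move=> noE; apply: xgetPN => n En; apply: noE; exists n.
(* Outside all epochs [xget] returns its default 0, so the fiber over 0 also contains the complement
   of their union. *)
rewrite (_ : [set w | _] = E k `|` (if k == 0%N then ~` \bigcup_n E n else set0)).
  apply: measurableU => //; case: eqP => // _.
  by apply: measurableC; exact: bigcup_measurable.
apply/seteqP; split => w /=.
  have [[n Enw]|noE] := pselect (exists n, E n w).
    by rewrite (xgetE _ _ Enw) => <-; left.
  rewrite xget0// => <-; rewrite eqxx; right => -[n _ Enw].
  by apply: noE; exists n.
move=> [/xgetE//|]; case: eqP => // -> noE.
by apply: xget0 => -[n Enw]; apply: noE; exists n.
Qed.

Lemma measurable_fibers_comp_nat (T : Type) (K : Omega -> nat) (F : nat -> Omega -> T) :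
  measurable_fibers K -> (forall k, measurable_fibers (F k)) ->
  measurable_fibers (fun w => F (K w) w).
Proof.
move=> mK mF v.
rewrite (_ : [set w | _] = \bigcup_k ([set w | K w = k] `&` [set w | F k w = v])).
  by apply: bigcup_measurable => k _; apply: measurableI; [exact: mK|exact: mF].
apply/seteqP; split => w /=; first by exists (K w).
by move=> [k _ [<-]].
Qed.

Lemma measurable_fibers_state (t : site -> nat -> {mfun Omega >-> R})
    (eta0 : site -> {mfun Omega >-> bool}) (u : site -> nat -> {mfun Omega >-> bool})
    (s : {mfun Omega >-> R}) (y : site) :
  (forall w n, t y n w < t y n.+1 w) ->
  measurable_fibers (fun w => state (fun y n => t y n w) (fun y => eta0 y w)
    (fun y n => u y n w) (s w) y).
Proof.
move=> t_incr; rewrite /state.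
apply: (measurable_fibers_comp_nat
  (F := fun n w => last_decision (fun y => eta0 y w) (fun y n => u y n w) y n)).
  exact: measurable_fibers_epoch.
by case=> [|k] /=; exact: measurable_fibers_funT.
Qed.

Lemma measurable_fibers_sum (I : Type) (r : seq I) (F : I -> Omega -> int) :
  (forall i, measurable_fibers (F i)) ->
  measurable_fibers (fun w => \sum_(i <- r) F i w).
Proof.
move=> mF; elim: r => [|i r IHr].
  by under eq_fun do rewrite big_nil; exact: measurable_fibers_cst.
under eq_fun do rewrite big_cons.
exact: (measurable_fibers2 (fun a b : int => a + b)).
Qed.

(** Couplings vanish off the edges, so the sum over a random neighbourhood becomes a sum over a
    fixed list. *)
Lemma fsbig_couplings_box (e : rel site) (J : site -> site -> int) (x : site)
    (eta : config) (M : nat) :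
  (forall y, ~~ e x y -> J x y = 0) -> (forall y, e x y -> (dist x y <= M)%N) ->
  \sum_(y \in [set y | e x y]) J x y * spinz (eta x) * spinz (eta y) =
  \sum_(y <- undup (box x M)) J x y * spinz (eta x) * spinz (eta y).
Proof.
move=> J0 eM; apply: fsbig_fwiden; last 2 first.
- exact: undup_uniq.
- by move=> y [_ /negP /J0 Jxy] /=; rewrite Jxy !mul0r.
by move=> y /eM/mem_box; rewrite -mem_undup.
Qed.

Lemma reward_lt0P (e : rel site) (J : site -> site -> int) (x : site) (eta : config) :
  (forall y, if e x y then J x y = 1 \/ J x y = -1 else J x y = 0) ->
  reward e J eta x < 0 <->
  exists M, (forall y, e x y -> (dist x y <= M)%N) /\
    \sum_(y <- undup (box x M)) J x y * spinz (eta x) * spinz (eta y) < 0.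
Proof.
move=> eJ; have J0 y : ~~ e x y -> J x y = 0.
  by have := eJ y; case: (e x y).
rewrite /reward sgr_lt0; split => [sum_lt0|[M [eM sum_lt0]]]; last first.
  by rewrite (fsbig_couplings_box eta J0 eM).
have e_fin : finite_set [set y | e x y].
  (* On an infinite neighbourhood every term is 1 or -1, so the sum is 0 by convention and not
     negative. The equivalence thus holds for every realization. *)
  apply: contrapT => e_inf; move: sum_lt0; rewrite fsbig_dflt ?ltxx//.
  apply: sub_infinite_set e_inf => y /= exy; split => //.
  by have := eJ y; rewrite exy => -[] ->; case: (eta x); case: (eta y).
have [M eM] := finite_set_box x e_fin.
by exists M; split => //; rewrite -(fsbig_couplings_box eta J0 eM).

Qed.

Lemma measurable_reward_lt0 (edge : Omega -> rel site)
    (j : Omega -> site -> site -> int) (eta : Omega -> config) (x : site) :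
  (forall y z, measurable [set w | edge w y z]) -> random_couplings edge j ->
  (forall y, measurable_fibers (fun w => eta w y)) ->
  measurable [set w | reward (edge w) (j w) (eta w) x < 0].
Proof.
move=> m_edge [m_j edge_j] m_eta.
pose S M w := \sum_(y <- undup (box x M)) j w x y * spinz (eta w x) * spinz (eta w y).
have mS M : measurable_fibers (S M).
  apply: measurable_fibers_sum => y.
  apply: (measurable_fibers2 (fun (a : int) b => a * spinz b)) => //.
  exact: (measurable_fibers2 (fun (a : int) b => a * spinz b)).
(* The intersection of [N M y] over [y] says that all neighbours of [x] lie within distance [M].
   Below, the values [- k.+1] enumerate the negative integers, which reduces [S M w < 0] to
   fibers. *)
pose N M y := if (dist x y <= M)%N then setT else ~` [set w | edge w x y].
rewrite (_ : [set w | _] = \bigcup_M (\bigcap_y N M y `&`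
    \bigcup_(k : nat) [set w | S M w = - k.+1%:Z])).
  apply: bigcup_measurable => M _; apply: measurableI.
    rewrite -[X in measurable X]setCK setC_bigcap; apply: measurableC.
    apply: countable_bigcupT_measurable => [|y]; first exact: countableP.
    by apply: measurableC; rewrite /N; case: ifP => // _; exact: measurableC.
  by apply: bigcup_measurable => k _; exact: mS.
apply/seteqP; split => w /=; rewrite (reward_lt0P _ (edge_j w x)).
  move=> [M [eM S_lt0]]; exists M => //; split.
    by move=> y _; rewrite /N; case: ifP => //= yM /eM; rewrite yM.
  exists (absz (S M w)).-1 => //=.
  by move: S_lt0; rewrite -/(S M w); lia.
move=> [M _ [eM [k _ Sk]]]; exists M; split => [y exy|].
  by have := eM y I; rewrite /N; case: ifP => //= _ /(_ exy).
by rewrite -/(S M w) Sk oppr_lt0.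
Qed.

End measurability.

Lemma measurable_sup_range (d : measure_display) (T : measurableType d) (R : realType)
    (a : nat -> T -> R) :
  (forall n, measurable_fun [set: T] (a n)) ->
  measurable_fun [set: T] (fun w => sup (range (a ^~ w))).
Proof.
move=> ma; rewrite (_ : (fun w => _) = fine \o (fun w => esups (fun n => (a n w)%:E) 0%N)).
  apply: measurableT_comp; first exact: fine_measurable.
  by apply: measurable_fun_esups => n; exact/measurable_EFinP.
apply/funext => w /=; rewrite /esups /= /sdrop.
rewrite [X in ereal_sup X](_ : _ = EFin @` range (a ^~ w)); last first.
  by apply/seteqP; split => _ [k kP <-]; [exists (a k w) => //; exists k|
     case: kP => n _ <-; exists n].
have ne : range (a ^~ w) !=set0 by exists (a 0%N w), 0%N.
(* In the unbounded case the two default values agree: [sup] is 0, and so is [fine] of +oo. *)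
have [ub|nub] := pselect (has_ubound (range (a ^~ w))); first by rewrite ereal_sup_EFin.
by rewrite hasNub_ereal_sup// sup_out// => -[].
Qed.

Lemma ae_forall_countable (d : measure_display) (T : measurableType d) (R : realType)
    (mu : {measure set T -> \bar R}) (I : countType) (Q : I -> T -> Prop) :
  (forall i, {ae mu, forall w, Q i w}) -> {ae mu, forall w, forall i, Q i w}.
Proof.
move=> aeQ.
have : {ae mu, forall w, forall n i, unpickle n = Some i -> Q i w}.
  apply: ae_foralln => n; case: (unpickle n) => [i|]; last exact: aeW.
  by apply: filterS (aeQ i) => w Qiw _ [<-].
by apply: filterS => w Qw i; apply: (Qw (pickle i)); exact: pickleK.
Qed.

Lemma g_sigma_algebra_preimage_subset (d : measure_display) (T : measurableType d)
    (R : realType) (G : set (set T)) (Z : T -> R) :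
  measurable_fun [set: g_sigma_algebraType G] (Z : g_sigma_algebraType G -> R) ->
  preimage_set_system setT Z measurable `<=` <<s G >>.
Proof. by move=> mZ _ [B mB <-]; exact: mZ. Qed.

(** * The random time after which no reward is negative *)

Theorem theorem1 (R : realType) (d : measure_display) (Omega : measurableType d)
    (P : probability Omega R)
    (edge : Omega -> rel site) (j : Omega -> site -> site -> int)
    (sigma0 : site -> {RV P >-> bool}) (t : site -> nat -> {RV P >-> R})
    (u : site -> nat -> {RV P >-> bool}) (x : site)
    (hgraph : random_graph P edge)
    (hcouplings : random_couplings edge j)
    (hsigma0 : forall y, fair (sigma0 y))
    (hclocks : forall y, rate1_poisson_process (t y))
    (hindep : mutually_independent P (source_sigma_alg t sigma0 (u x 1%N)))
    (hpi : adopts_pi edge j sigma0 t u x) :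
  exists T : Omega -> \bar R,
    [/\ measurable_fun [set: Omega] T,
        forall w, (0 <= T w)%E,
        {ae P, forall w, (T w < +oo)%E} &
        {ae P, forall w, forall n, (0 < n)%N -> (T w <= (t x n w)%:E)%E ->
           0 <= reward_at edge j sigma0 t u x (t x n w) w}].
Proof.
have [edge_rel m_edge _ edge_fin] := hgraph.
have t0 w y : t y 0%N w = 0 by case: (hclocks y).
have t_incr w y n : t y n w < t y n.+1 w by case: (hclocks y).
have t_le w y : {homo (fun n => t y n w) : n k / (n <= k)%N >-> n <= k}.
  by apply: (homo_leq lexx le_trans) => n; exact: ltW.
pose bad n := [set w | reward_at edge j sigma0 t u x (t x n w) w < 0].
have m_bad n : measurable (bad n).
  apply: measurable_reward_lt0 => // y.
  by apply: measurable_fibers_state => w k; exact: t_incr.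
(* T dominates t_{n+1}, not only t_n, for each negative h_n, because the
   conclusion includes the decision times equal to T. *)
pose T w := esups (fun n => (t x n.+1 w * \1_(bad n) w)%:E) 0%N.
have T_ge n w : bad n w -> ((t x n.+1 w)%:E <= T w)%E.
  move=> nw; apply: ereal_sup_ubound; exists n => //.
  by rewrite indicE mem_set// mulr1.
exists T; split.
- apply: measurable_fun_esups => n; apply/measurable_EFinP.
  by apply: measurable_funM; [exact: measurable_funPT|exact: measurable_indic].
- move=> w; apply: (@le_trans _ _ (t x 1%N w * \1_(bad 0%N) w)%:E).
    by rewrite lee_fin mulr_ge0// -(t0 w x) t_le.
  by apply: ereal_sup_ubound; exists 0%N.
- have sub_sigma y : sigma_alg_of_seq (t y) `<=` measurable.
    apply: smallest_sub; first exact: sigma_algebra_measurable.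
    by move=> A [n _ [B mB <-]]; exact: measurable_funPT.
  (* Measurability for the sigma-algebra of the clock of [y] alone, which its explosion time
     [sup (range _)] inherits, so that independence from the clock of [x] applies to both. *)
  have m_past y n : measurable_fun
      [set: g_sigma_algebraType (\bigcup_n sigma_alg_of (t y n))]
      (t y n : g_sigma_algebraType (\bigcup_n sigma_alg_of (t y n)) -> R).
    by move=> _ B mB; apply: sub_sigma_algebra; exists n => //; exists B.
  have neq y n (Z : Omega -> R) : y != x -> (0 < n)%N ->
      preimage_set_system setT Z measurable `<=` sigma_alg_of_seq (t y) ->
      {ae P, forall w, Z w != t x n w}.
    move=> yx n0 Z_sigma.
    apply: (arrival_neq (i := inl (inl x)) (k := inl (inl y)) hindep) => //.
      by apply: contra yx => /eqP[->].
    exact: sub_sigma.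
  have t_neq : {ae P, forall w, forall y n k, y != x -> (0 < n)%N -> t y k w != t x n w}.
    apply: ae_forall_countable => y; apply: ae_foralln => n; apply: ae_foralln => k.
    have [->|yx] := eqVneq y x; first exact: aeW.
    have [->|n0] := posnP n; first exact: aeW.
    have := neq y n (t y k) yx n0 (g_sigma_algebra_preimage_subset (m_past y k)).
    by apply: filterS => w.
  have sup_neq : {ae P, forall w, forall y n, y != x -> (0 < n)%N ->
      sup (range (fun k => t y k w)) != t x n w}.
    apply: ae_forall_countable => y; apply: ae_foralln => n.
    have [->|yx] := eqVneq y x; first exact: aeW.
    have [->|n0] := posnP n; first exact: aeW.
    have := neq y n _ yx n0 (g_sigma_algebra_preimage_subset
      (measurable_sup_range (m_past y))).
    by apply: filterS => w.
  apply: filterS3 (edge_fin x) t_neq sup_neq => w finw tw supw.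
  have [N badN] := rewards_eventually_ge0 (t0 w) (t_incr w) (proj2 (edge_rel w))
    finw tw supw (hpi.2 w).
  (* A bad index [n] satisfies [n < N], so its term [t x n.+1 w] is at most [t x N w]; the other
     terms are 0. *)
  apply: (@le_lt_trans _ _ (t x N w)%:E); last exact: ltry.
  apply: ge_ereal_sup => _ [n _ <-]; rewrite lee_fin indicE.
  have [/set_mem nw|_] := boolP (w \in bad n); last by rewrite mulr0 -(t0 w x) t_le.
  rewrite mulr1 t_le// ltnNge; apply/negP => /badN.
  by rewrite leNgt => /negP; apply.
(* A negative reward at [t x n w] would give [t x n.+1 w <= T w <= t x n w], against strict
   increase. *)
- apply: aeW => w n n0 Tn; rewrite leNgt; apply/negP => /T_ge.
  by move=> /le_trans/(_ Tn); rewrite lee_fin leNgt t_incr.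
Qed.
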